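(* Let $n \geq 1$ be an odd integer and let $q \in \mathbb{C}$ be a primitive $n$th root of unity. Then $$\sum_{k \geq 0} (q;q^2)_k = \frac{-1}{n^2} \sum_{k=-n}^{n-1} \sum_{j=-k}^k \mathrm{sgn}(k) \left(\frac{k(3k+1)}{2} - j^2\right)(-1)^{k+j}q^{-k(3k+1)/2 + j^2}.$$
   Context: For a non-negative integer $k$, $(q;q^2)_k=\prod_{i=0}^{k-1}(1-q^{2i+1})$. For $q$ a primitive $n$th root of unity with $n$ odd, $(q;q^2)_k=0$ for all $k \geq (n+1)/2$, so the sum on the left is finite. The sign function is $\mathrm{sgn}(k)=1$ if $k \geq 0$ and $\mathrm{sgn}(k)=-1$ if $k<0$. Sums with reversed limits follow the convention that for any $f$, $\sum_{j=a}^b f(j) = - \sum_{j=b+1}^{a-1} f(j)$ whenever $a > b$; in particular, for $k<0$, $\sum_{j=-k}^{k} f(j) = -\sum_{j=k+1}^{-k-1} f(j)$. *)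

(* Defs.v *)
From mathcomp Require Import all_boot all_order all_algebra.
From mathcomp Require Import zify ring.
From mathcomp Require Import boolp classical_sets cardinality fsbigop reals.
From mathcomp Require Export complex.

Set Implicit Arguments.
Unset Strict Implicit.
Unset Printing Implicit Defensive.

Import Order.TTheory GRing.Theory Num.Theory.
Local Open Scope ring_scope.

(* The q-Pochhammer symbol (q; q^2)_k. *)
Definition qpoch_odd (F : comNzRingType) (q : F) (k : nat) : F :=
  \prod_(i < k) (1 - q ^+ (2 * i + 1)).

(* Unlike [sgz], this takes the value 1 at 0. *)
Definition sgn (k : int) : int := if 0 <= k then 1 else -1.

(* The quotient is exact, see [pentE]. *)
Definition pent (k : int) : int := ((k * (3 * k + 1)) %/ 2)%Z.

(* Sum of f over the integers from a to b inclusive, with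
   sumz a b f = - sumz (b + 1) (a - 1) f when a > b. In the second branch the
   range b + 1, ..., a - 1 has a - b - 1 elements, so it is empty if
   a = b + 1. *)
Definition sumz (V : zmodType) (a b : int) (f : int -> V) : V :=
  if a <= b then \sum_(0 <= i < absz (b - a + 1)%R) f (a + i%:Z)
  else - \sum_(0 <= i < absz (a - b - 1)%R) f (b + 1 + i%:Z).

Lemma pentE (k : int) : pent k * 2 = k * (3 * k + 1).
Proof.
rewrite /pent divzK //.
have -> : k * (3 * k + 1) = (k %/ 2)%Z * (6 * k + 2) + (k %% 2)%Z * (3 * k + 1).
  rewrite {1}(divz_eq k 2); ring.
have /orP[/eqP e|/eqP e] : ((k %% 2)%Z == 0) || ((k %% 2)%Z == 1) by lia.
  rewrite e; apply/dvdzP; exists ((k %/ 2)%Z * (3 * k + 1)); ring.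
have ek : k = (k %/ 2)%Z * 2 + 1 by rewrite {1}(divz_eq k 2) e.
apply/dvdzP; exists ((k %/ 2)%Z * (3 * k + 1) + (3 * (k %/ 2)%Z + 2)).
by rewrite e; move: (k %/ 2)%Z ek => m ->; ring.
Qed.

Lemma sumz_rev (V : zmodType) (a b : int) (f : int -> V) :
  b < a -> sumz a b f = - sumz (b + 1) (a - 1) f.
Proof.
move=> ba; rewrite /sumz leNgt ba /=.
case: ifPn => [_|h]; first by congr (- _); congr bigop; congr index_iota; lia.
have -> : a = b + 1 by lia.
have -> : absz (b + 1 - b - 1)%R = 0%N by lia.
have -> : absz (b + 1 - (b + 1 - 1) - 1)%R = 0%N by lia.
by rewrite !big_geq // !oppr0.
Qed.

(* Main.v *)
Require Import Defs.
From mathcomp Require Import all_boot all_order all_algebra.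
From mathcomp Require Import boolp classical_sets cardinality fsbigop reals.
From mathcomp Require Import zify ring.

(** Write [p] for the inverse of [q] and [(a)_k] for the product of the
    [1 - a p^i], [i < k]. Folding [k] with [-k-1], the double sum on the right
    is [p P'(p)] for the polynomial
      P(X) = sum_(r < n) (-1)^r (1 - X^(2r+1)) X^(r(r+1)/2)
               sum_(-r <= j <= r) (-1)^j X^(r^2 - j^2),
    since the weight [k(3k+1)/2 - j^2] is the exponent of the monomial. So the
    claim is [p P'(p) = - n^2 sum_k (q; q^2)_k].

    The terms of [P] form the first half of a Bailey pair. Two terminating
    summations, q-Gauss ([theta_expand]) and q-Chu-Vandermonde
    ([falling_expand]), expand them in a basis for which the factor
    [1 - X^(2r+1)] makes the sum over [r] telescope ([telescope_sum]). Thus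
    [P] is [1 - X^n] times a rational function that is regular at [p]
    ([hecke_telescoped], [hecke_poly]), and the derivative at [p] is [-n] times
    the value of that function, which turns out to be
      sum_(m < n) sum_(k <= m) p^(k(k+1)/2) / (-p)_k * (p)_m / (p)_(m-k).
    For fixed [k < n] the last quotient is a polynomial in [p^m] of degree
    [k] with constant term 1, so its sum over [m] is [n] ([sum_qfall]). This
    leaves [- n^2 sum_k p^(k(k+1)/2) / (-p)_k], and as [n] is odd the terms of
    this sum are the [(-p)_m], [m < n], in reverse order ([sum_inv_qpochN]).

    It remains to see that the sums of the [(-p)_m] and of the [(q; q^2)_k] are
    equal. The former are expanded by the q-binomial theorem in base [p], the
    latter are alternating sums of even rows of q-binomial coefficients in base
    [q], the odd rows summing to 0. In both cases the sum of a column of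
    q-binomial coefficients is known ([sum_qbin], again the averaging over roots
    of unity), and both sums become [n sum_(r < n) (-1)^r / (q; q)_r]. *)

Set Implicit Arguments.
Unset Strict Implicit.
Unset Printing Implicit Defensive.

Import Order.TTheory GRing.Theory Num.Theory.
Local Open Scope ring_scope.

(** * Index bookkeeping *)

Lemma bin2S n : 'C(n.+1, 2) = ('C(n, 2) + n)%N.
Proof. by rewrite binS bin1. Qed.

Lemma bin2D k d : 'C(k + d, 2) = ('C(k, 2) + 'C(d, 2) + k * d)%N.
Proof.
elim: d => [|d IH]; first by rewrite addn0 muln0 !addn0.
by rewrite addnS !bin2S IH; lia.
Qed.

Lemma bin2_sq d : (2 * 'C(d, 2) + d = d * d)%N.
Proof. by elim: d => [//|d IH]; rewrite bin2S; lia. Qed.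

Lemma big_ord_window (V : nmodType) (F : nat -> V) k s n : (k + s < n)%N ->
  (forall m, (m < k)%N -> F m = 0) -> (forall m, (k + s < m)%N -> F m = 0) ->
  \sum_(m < n) F m = \sum_(u < s.+1) F (k + u)%N.
Proof.
move=> kn Fk Fs; rewrite -(subnKC kn) -addnS big_split_ord /=.
rewrite [X in _ + X]big1 ?addr0 => [|i _]; last by rewrite Fs //; lia.
by rewrite big_split_ord /= big1 ?add0r // => i _; rewrite Fk.
Qed.

(** * Pochhammer products and q-binomial coefficients *)

Definition qpoch (R : comNzRingType) (a x : R) (k : nat) : R :=
  \prod_(i < k) (1 - a * x ^+ i).

(** For [k > n] the truncated subtraction makes the factor of index [n]
    vanish, so sums weighted by [qfall] need no range conditions. *)
Definition qfall (R : comNzRingType) (x : R) (n k : nat) : R :=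
  \prod_(i < k) (1 - x ^+ (n - i)).

(** The recursion avoids quotients, so that the coefficients also make sense at
    a root of unity and in rings of polynomials. *)
Fixpoint qbin (R : comNzRingType) (x : R) (n k : nat) : R :=
  match n, k with
  | _, 0 => 1
  | 0, _.+1 => 0
  | n'.+1, k'.+1 => x ^+ k * qbin x n' k + qbin x n' k'
  end.

Section QBinomial.
Variable R : comNzRingType.
Implicit Types a b c w x : R.

Lemma qpoch0 a x : qpoch a x 0 = 1.
Proof. by rewrite /qpoch big_ord0. Qed.

Lemma qpochS a x k : qpoch a x k.+1 = qpoch a x k * (1 - a * x ^+ k).
Proof. by rewrite /qpoch big_ord_recr. Qed.

Lemma qpochD a x k l :
  qpoch a x (k + l) = qpoch a x k * qpoch (a * x ^+ k) x l.
Proof.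
rewrite /qpoch big_split_ord /=; congr (_ * _).
by apply: eq_bigr => i _; rewrite exprD mulrA.
Qed.

Lemma qpochSl a x k : qpoch a x k.+1 = (1 - a) * qpoch (a * x) x k.
Proof. by rewrite -add1n qpochD qpochS qpoch0 mul1r expr0 mulr1 expr1. Qed.

Lemma qpoch_shift x n k :
  qpoch x x (n + k) = qpoch x x n * qpoch (x ^+ n.+1) x k.
Proof. by rewrite qpochD exprS. Qed.

Lemma prod_expr x s : \prod_(i < s) x ^+ i = x ^+ 'C(s, 2).
Proof.
elim: s => [|s IH]; first by rewrite big_ord0.
by rewrite big_ord_recr /= IH bin2S exprD.
Qed.

Lemma qfall0 x n : qfall x n 0 = 1.
Proof. by rewrite /qfall big_ord0. Qed.

Lemma qfallD x n k l : qfall x n (k + l) = qfall x n k * qfall x (n - k) l.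
Proof.
rewrite /qfall big_split_ord /=; congr (_ * _).
by apply: eq_bigr => i _; rewrite subnDA.
Qed.

Lemma qfallS x n k : qfall x n k.+1 = qfall x n k * (1 - x ^+ (n - k)).
Proof. by rewrite /qfall big_ord_recr. Qed.

Lemma qfallSS x n k : qfall x n.+1 k.+1 = (1 - x ^+ n.+1) * qfall x n k.
Proof. by rewrite /qfall big_ord_recl. Qed.

Lemma qfall_small x n k : (n < k)%N -> qfall x n k = 0.
Proof.
by move=> nk; rewrite /qfall (bigD1 (Ordinal nk)) //= subnn expr0 subrr mul0r.
Qed.

Lemma qfall_qpoch x n k : qfall x (n + k) k * qpoch x x n = qpoch x x (n + k).
Proof.
elim: k => [|k IH]; first by rewrite qfall0 mul1r addn0.
by rewrite addnS qfallSS qpochS -IH exprS; ring.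
Qed.

Lemma qbin0 x n : qbin x n 0 = 1. Proof. by case: n. Qed.

Lemma qbin_small x n k : (n < k)%N -> qbin x n k = 0.
Proof.
elim: n k => [|n IH] [|k] //= nk.
by rewrite !IH ?mulr0 ?addr0 // ltnW.
Qed.

Lemma qbinS x n k :
  qbin x n.+1 k.+1 = x ^+ k.+1 * qbin x n k.+1 + qbin x n k.
Proof. by []. Qed.

(** Induction on [n]: after the Pascal rule, the term of index [k.+1] is handled
    by the same identity one step earlier, already multiplied by a power of [x],
    so that no power of [x] has to be cancelled. *)
Lemma qbin_absorb x n k :
  (1 - x ^+ k.+1) * qbin x n.+1 k.+1 = (1 - x ^+ n.+1) * qbin x n k.
Proof.
elim: n k => [|n IH] k.
  by case: k => [|k] /=; ring.
rewrite qbinS mulrDr mulrCA IH.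
case: k => [|k]; first by rewrite !qbin0 !exprS; ring.
have e : x ^+ k.+1 * ((1 - x ^+ n.+1) * qbin x n k.+1) =
   (x ^+ k.+1 - x ^+ n.+1) * qbin x n.+1 k.+1.
  have -> : x ^+ k.+1 * ((1 - x ^+ n.+1) * qbin x n k.+1) =
    (1 - x ^+ n.+1) * (qbin x n.+1 k.+1 - qbin x n k).
    by rewrite qbinS; ring.
  by rewrite mulrBr -IH; ring.
by rewrite [x ^+ k.+2]exprS -mulrA e [x ^+ n.+2]exprS; ring.
Qed.

Lemma qbin_qpoch x n k : qbin x n k * qpoch x x k = qfall x n k.
Proof.
elim: k n => [|k IH] [|n]; rewrite ?qpoch0 ?qfall0 ?qbin0 ?mulr1 //.
  by rewrite qfall_small // mul0r.
rewrite qfallSS -IH qpochS -exprS.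
by rewrite [RHS]mulrA -qbin_absorb; ring.
Qed.

Lemma qbin_sumS x n (f : nat -> R) :
  \sum_(k < n.+2) qbin x n.+1 k * f k =
  \sum_(k < n.+1) qbin x n k * (x ^+ k * f k + f k.+1).
Proof.
rewrite big_ord_recl /=.
under eq_bigr do rewrite /bump /= add1n mulrDl.
rewrite big_split /=.
under [RHS]eq_bigr do rewrite mulrDr.
rewrite big_split /= addrA; congr (_ + _).
rewrite [RHS]big_ord_recl /= qbin0 expr0 !mul1r; congr (_ + _).
rewrite big_ord_recr /= qbin_small // mulr0 mul0r addr0.
by apply: eq_bigr => i _; rewrite /bump /= add1n; ring.
Qed.

#[global] Arguments qbin : simpl never.

Lemma qbin_binomial x w r :
  \sum_(k < r.+1) qbin x r k * ((- w) ^+ k * x ^+ 'C(k, 2)) = qpoch w x r.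
Proof.
elim: r w => [|r IH] w.
  by rewrite big_ord_recl big_ord0 /= qbin0 qpoch0 !expr0 !mulr1 addr0.
rewrite (qbin_sumS x r (fun k => (- w) ^+ k * x ^+ 'C(k, 2))) qpochSl -IH.
rewrite mulr_sumr; apply: eq_bigr => k _ /=.
by rewrite bin2S exprD exprS -mulNr exprMn; ring.
Qed.

(** The q-analogue of the Gauss sum for a terminating 2phi1, made homogeneous in
    [b] and [c] so that it holds in any commutative ring. The Pascal rule turns
    the sum for [r.+1] into [b - c] times the sum for [r] with [c * x] in place
    of [c]. *)
Lemma qbin_gauss x b c r :
  \sum_(k < r.+1) qbin x r k * ((- c) ^+ k * b ^+ (r - k) * x ^+ 'C(k, 2)
     * qpoch b x k * qpoch (c * x ^+ k) x (r - k))
  = \prod_(i < r) (b - c * x ^+ i).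
Proof.
elim: r c => [|r IH] c.
  by rewrite big_ord_recl !big_ord0 /= qbin0 !expr0 !qpoch0 !mulr1 addr0.
rewrite (qbin_sumS x r (fun k => (- c) ^+ k * b ^+ (r.+1 - k) * x ^+ 'C(k, 2)
     * qpoch b x k * qpoch (c * x ^+ k) x (r.+1 - k))).
rewrite [RHS]big_ord_recl expr0 mulr1.
under [in RHS]eq_bigr do rewrite /bump /= ?add1n exprS mulrA.
rewrite -IH mulr_sumr; apply: eq_bigr => -[k kr] _ /=.
rewrite subSS subSn // qpochSl qpochS binS bin1 exprD !exprS.
have -> : (- (c * x)) ^+ k = (- c) ^+ k * x ^+ k by rewrite -mulNr exprMn.
have -> : c * x * x ^+ k = c * x ^+ k * x by ring.
have -> : c * (x * x ^+ k) = c * x ^+ k * x by ring.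
by ring.
Qed.

(** The companion q-Chu-Vandermonde sum, with argument [x] in the 2phi1. It
    expresses that the [s]-th x-difference of a Pochhammer product is again a
    product. The Pascal rule splits the sum for [s.+1] into the sums for
    [(b, c)] and [(b * x, c * x)], which are proportional by induction. *)
Lemma qbin_vandermonde x b c s :
  \sum_(k < s.+1) qbin x s k * ((-1) ^+ (s - k) * x ^+ 'C(s - k, 2)
     * qpoch b x k * qpoch (c * x ^+ k) x (s - k))
  = \prod_(i < s) (x ^+ i * (c * x ^+ i - b)).
Proof.
elim: s b c => [|s IH] b c.
  by rewrite big_ord_recl !big_ord0 /= qbin0 !expr0 !qpoch0 !mulr1 addr0.
rewrite (qbin_sumS x s (fun k => (-1) ^+ (s.+1 - k) * x ^+ 'C(s.+1 - k, 2)
     * qpoch b x k * qpoch (c * x ^+ k) x (s.+1 - k))).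
have e : \prod_(i < s) (x ^+ i * (c * x * x ^+ i - b * x)) =
    x ^+ s * \prod_(i < s) (x ^+ i * (c * x ^+ i - b)).
  have -> : x ^+ s = \prod_(i < s) x by rewrite prodr_const card_ord.
  by rewrite -big_split /=; apply: eq_bigr => i _; ring.
rewrite [RHS]big_ord_recr /=.
transitivity (- x ^+ s * (1 - c * x ^+ s) * \prod_(i < s) (x ^+ i * (c * x ^+ i
  - b))
   + (1 - b) * \prod_(i < s) (x ^+ i * (c * x * x ^+ i - b * x))); last first.
  by rewrite e; ring.
rewrite -(IH b c) -(IH (b * x) (c * x)) !mulr_sumr -big_split /=.
apply: eq_bigr => -[k kr] _ /=.
rewrite subSS subSn // qpochS qpochSl binS bin1 exprD exprS.
have -> : c * x ^+ k * x ^+ (s - k) = c * x ^+ s.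
  by rewrite -mulrA -exprD subnKC.
have -> : x ^+ s = x ^+ k * x ^+ (s - k) by rewrite -exprD subnKC.
have -> : c * x * x ^+ k = c * x ^+ k.+1 by rewrite exprS; ring.
by ring.
Qed.

(** The recurrence behind the Gauss evaluation of the alternating sum of a row of
    q-binomial coefficients; it yields [(x; x^2)_k] on row [2k] and 0 on odd
    rows. *)
Lemma qbin_alt x M :
  \sum_(r < M.+3) qbin x M.+2 r * (-1) ^+ r =
  (1 - x ^+ M.+1) * \sum_(r < M.+1) qbin x M r * (-1) ^+ r.
Proof.
rewrite (qbin_sumS x M.+1 (fun r => (-1) ^+ r)) big_ord_recl qbin0 expr0.
rewrite expr1 mulr_sumr !mul1r subrr add0r.
apply: eq_bigr => i _ /=; rewrite /bump /= add1n.
rewrite mulrA -qbin_absorb [(-1) ^+ i.+2]exprS [(-1) ^+ i.+1]exprS; ring.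
Qed.

Lemma qbin_alt_even x k :
  \sum_(r < k.*2.+1) qbin x k.*2 r * (-1) ^+ r = qpoch_odd x k.
Proof.
elim: k => [|k IH].
  by rewrite /qpoch_odd big_ord_recl !big_ord0 /= qbin0 expr0 mulr1 addr0.
rewrite doubleS qbin_alt IH /qpoch_odd big_ord_recr /= mulrC.
by congr (_ * (1 - x ^+ _)); lia.
Qed.

Lemma qbin_alt_odd x k :
  \sum_(r < k.*2.+2) qbin x k.*2.+1 r * (-1) ^+ r = 0.
Proof.
elim: k => [|k IH]; last by rewrite doubleS qbin_alt IH mulr0.
by rewrite !big_ord_recl !big_ord0 /= qbinS !qbin0 qbin_small //; ring.
Qed.

(** The link between the left-hand side of the theorem and q-binomial
    coefficients: only the rows of even index contribute. *)
Lemma sum_qbin_alt x h :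
  \sum_(M < h.*2.+1) \sum_(r < h.*2.+1) qbin x M r * (-1) ^+ r =
  \sum_(k < h.+1) qpoch_odd x k.
Proof.
transitivity (\sum_(M < h.*2.+1) \sum_(r < M.+1) qbin x M r * (-1) ^+ r).
  apply: eq_bigr => -[M Mh] _ /=.
  rewrite (@big_ord_window _ (fun r => qbin x M r * (-1) ^+ r) 0 M) //.
  by move=> r Mr; rewrite qbin_small ?mul0r.
elim: h => [|h IH]; first by rewrite !big_ord1 qbin0 mulr1 /qpoch_odd big_ord0.
rewrite doubleS big_ord_recr /= big_ord_recr /= IH qbin_alt_odd addr0.
by rewrite [RHS]big_ord_recr -qbin_alt_even.
Qed.

End QBinomial.

(** * The Hecke-type sum and its telescoped form *)

(** With [j = i - r] this is the sum of [(-1)^j x^(r^2 - j^2)] over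
    [-r <= j <= r]; the power [x^(r^2)] keeps the exponents natural. *)
Definition theta (R : comNzRingType) (x : R) (r : nat) : R :=
  \sum_(i < (2 * r).+1) (-1) ^+ (i + r) * x ^+ (i * (2 * r - i)).

(** The indefinite theta sum of the theorem, without the linear weights: the
    indices [k = r] and [k = - r - 1] of the theorem are folded into the factor
    [1 - x^(2r+1)], and [x] stands for the inverse of [q]. *)
Definition hecke (R : comNzRingType) (x : R) (n : nat) : R :=
  \sum_(r < n) (1 - x ^+ (2 * r).+1) * ((-1) ^+ r * x ^+ 'C(r.+1, 2) * theta x r).

(** The antidifference in [r], taken at [r = n], of the basis element of index
    [m] weighted by [1 - x^(2r+1)]; see [telescope_sum]. *)
Definition telescoped (R : comNzRingType) (x : R) (n m : nat) : R :=
  (-1) ^+ (n + m).+1 * x ^+ 'C(n - m, 2) * qfall x (n + m) (2 * m).+1.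

Section HeckeSum.
Variable R : comNzRingType.
Implicit Types x : R.

(** The two outermost terms [j = -r-1] and [j = r+1] are split off; the others
    are those of [theta x r] times a common power of [x]. *)
Lemma theta_rec x r :
  theta x r.+1 = x ^+ (2 * r).+1 * theta x r + 2 * (-1) ^+ r.+1.
Proof.
rewrite /theta mulnS big_ord_recl big_ord_recr /= /bump /= add0n mul0n expr0 mulr1.
rewrite mulr_sumr.
have -> : ((2 * r).+2 - (2 * r).+2)%N = 0%N by lia.
have -> : (-1) ^+ ((2 * r).+2 + r.+1) = (-1) ^+ r.+1 :> R.
  by rewrite -signr_odd -[RHS]signr_odd; congr (_ ^+ nat_of_bool _); lia.
rewrite muln0 expr0.
under eq_bigr => i _.
  have ir := ltn_ord i.
  rewrite [X in x ^+ X](_ : _ = ((2 * r).+1 + i * (2 * r - i))%N); last by nia.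
  rewrite [x ^+ (_ + _)]exprD add1n addSn addnS 2!(exprS (-1)) mulrA mulN1r
    opprK mul1r mulrCA.
  over.
by rewrite /=; ring.
Qed.

(** This is why the finite sum is accessible: the factor [1 - x^(2r+1)] makes
    each basis element a difference of consecutive values of [telescoped], and
    [telescoped x n m] contains the factor [1 - x^n]. *)
Lemma telescope_sum x n m :
  \sum_(r < n) (1 - x ^+ (2 * r).+1) *
     ((-1) ^+ (r + m) * x ^+ 'C(r - m, 2) * qfall x (r + m) (2 * m)) =
       telescoped x n m.
Proof.
elim: n => [|n IH]; first by rewrite big_ord0 /telescoped qfall_small ?mulr0
  //; lia.
rewrite big_ord_recr /= IH /telescoped addSn qfallS qfallSS.
have -> : (n + m - 2 * m = n - m)%N by lia.
case: (leqP m n) => mn; last by rewrite qfall_small ?mul0r ?mulr0 ?addr0 //; lia.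
rewrite subSn // bin2S ![(-1) ^+ _.+1]exprS; move: ((-1) ^+ (n + m)) => sgn.
have -> : (n + m).+1 = (n - m + 2 * m).+1 by lia.
have -> : (2 * n).+1 = (n - m + (n - m + 2 * m).+1)%N by lia.
rewrite !exprD !exprS; ring.
Qed.

End HeckeSum.

(** The second member of the Bailey pair relative to [x] whose first member is
    [(1 - x^(2r+1)) / (1 - x) (-1)^r x^(r(r+1)/2) theta x r]. Terms with [k > m]
    vanish, so the bound [n] is immaterial as soon as [m < n]. *)
Definition bailey_beta (F : fieldType) (x : F) (n m : nat) : F :=
  (\sum_(k < n) x ^+ 'C(k.+1, 2) * qfall x m k / qpoch (- x) x k)
    / qpoch x x m ^+ 2.

Section Field.
Variables (F : fieldType) (x : F).
Hypothesis x0 : x != 0.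
Hypothesis xP : forall k, qpoch x x k != 0.
Hypothesis xN : forall k, qpoch (- x) x k != 0.

Lemma sub1X_neq0 k : 1 - x ^+ k.+1 != 0.
Proof. by have := xP k.+1; rewrite qpochS mulf_eq0 -exprS => /norP[]. Qed.

Lemma add1X_neq0 k : 1 + x ^+ k.+1 != 0.
Proof. by have := xN k.+1; rewrite qpochS mulf_eq0 mulNr opprK -exprS =>
  /norP[]. Qed.

Lemma qbin_fact k d : qbin x (k + d) k =
  qpoch x x (k + d) / (qpoch x x k * qpoch x x d).
Proof.
apply: (mulIf (xP k)); rewrite qbin_qpoch addnC; apply: (mulIf (xP d)).
by rewrite qfall_qpoch; field; rewrite !xP.
Qed.

Lemma qfall_ratio n k : qfall x (n + k) k = qpoch x x (n + k) / qpoch x x n.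
Proof. by rewrite -qfall_qpoch mulfK. Qed.

(** The instance [b = x^(r+1)], [c = -x] of [qbin_gauss], divided by Pochhammer
    products. *)
Lemma sum_theta_step r :
  \sum_(k < r.+2) x ^+ 'C(r.+1 - k, 2) * qpoch x x (r + k) /
     (qpoch x x (r.+1 - k) * qpoch x x k * qpoch (- x) x k)
  = 2 / (1 - x ^+ (2 * r.+1)).
Proof.
have prodE : \prod_(i < r.+1) (x ^+ r.+1 - - x * x ^+ i) =
    x ^+ 'C(r.+2, 2) * (2 * qpoch (- x) x r).
  transitivity (\prod_(i < r.+1) (x * x ^+ i) * \prod_(i < r.+1) (1 + x ^+ (r -
    i))).
    rewrite -big_split /=; apply: eq_bigr => -[i ir] _ /=.
    rewrite -{1}(subnKC ir) addSn exprS exprD subSS; ring.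
  congr (_ * _).
    by rewrite big_split /= prodr_const card_ord prod_expr [in RHS]bin2S exprD
      mulrC.
  rewrite (reindex_inj rev_ord_inj) /=.
  transitivity (qpoch (- 1) x r.+1); last by rewrite qpochSl mulN1r opprK.
  apply: eq_bigr => -[i ir] _ /=; rewrite mulN1r opprK; congr (1 + x ^+ _); lia.
have gauss := qbin_gauss x (x ^+ r.+1) (- x) r.+1; rewrite {}prodE in gauss.
have d0 := sub1X_neq0 r; have a0 := add1X_neq0 r.
have xr0 : x ^+ 'C(r.+2, 2) != 0 by rewrite expf_neq0.
have sq : 1 - x ^+ (2 * r.+1) = (1 - x ^+ r.+1) * (1 + x ^+ r.+1).
  by rewrite mul2n -addnn exprD; ring.
rewrite sq.
transitivity ((x ^+ 'C(r.+2, 2) * (2 * qpoch (- x) x r)) /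
   (x ^+ 'C(r.+2, 2) * (1 - x ^+ r.+1) * qpoch (- x) x r.+1)); last first.
  by rewrite qpochS mulNr opprK -exprS; field; rewrite xr0 xN a0 d0.
rewrite -{}gauss mulr_suml; apply: eq_bigr => -[k kr] _ /=.
(* d = r + 1 - k replaces the truncated subtraction. *)
have [d ed] : exists d, r.+1 = (k + d)%N by exists (r.+1 - k)%N; lia.
have ebin : ('C(r.+2, 2) + 'C(d, 2) = k + (k + d) * d + 'C(k, 2))%N.
  by have := bin2_sq d; rewrite bin2S ed bin2D; lia.
have epoch : qpoch x x (r + k) * (1 - x ^+ r.+1)
    = qpoch x x (k + d) * qpoch (x ^+ r.+1) x k.
  rewrite -ed qpochS -exprS qpoch_shift.
  by ring.
have eN : qpoch (- x) x r.+1 = qpoch (- x) x k * qpoch (- x * x ^+ k) x d.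
  by rewrite ed qpochD.
have -> : (r.+1 - k = d)%N by lia.
have -> : qpoch (x ^+ r.+1) x k =
    qpoch x x (r + k) * (1 - x ^+ r.+1) / qpoch x x (k + d).
  by rewrite epoch mulrC mulKf.
have -> : x ^+ 'C(d, 2) = x ^+ k * x ^+ r.+1 ^+ d * x ^+ 'C(k, 2) / x ^+
  'C(r.+2, 2).
  by rewrite -exprM [in (r.+1 * _)%N]ed -!exprD -ebin exprD mulrC mulKf.
have -> : qbin x r.+1 k = qbin x (k + d) k by rewrite ed.
rewrite qbin_fact opprK eN; field.
have := xN r.+1; rewrite eN mulf_eq0 => /norP[Nk Nd].
by rewrite xr0 Nk Nd d0 !xP.
Qed.

(** Both sides satisfy the recurrence [theta_rec]: two consecutive sums on the
    right combine, term by term, into the sum evaluated by [sum_theta_step]. *)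
Lemma theta_expand n r : (r < n)%N ->
  theta x r = (-1) ^+ r * \sum_(k < n) x ^+ 'C(r - k, 2) *
     qfall x (r + k) (2 * k) / (qpoch x x k * qpoch (- x) x k).
Proof.
set t := fun r k => x ^+ 'C(r - k, 2) *
     qfall x (r + k) (2 * k) / (qpoch x x k * qpoch (- x) x k).
rewrite -/(t r _) => rn.
have t0 r' k : (r' < k)%N -> t r' k = 0.
  by move=> rk; rewrite /t qfall_small ?mulr0 ?mul0r //; lia.
have -> : \sum_(k < n) t r k = \sum_(k < r.+1) t r k.
  by rewrite (@big_ord_window _ (t r) 0 r n) // => m; apply: t0.
elim: r {rn} => [|r IH].
  rewrite /theta !big_ord_recl !big_ord0 /t /= !qfall0 !qpoch0 mul0n !expr0.
  by field; rewrite oner_eq0.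
rewrite theta_rec {}IH [(-1) ^+ r.+1]exprS.
have step : \sum_(k < r.+2) t r.+1 k + x ^+ (2 * r).+1 * \sum_(k < r.+1) t r k = 2.
  have -> : \sum_(k < r.+1) t r k = \sum_(k < r.+2) t r k.
    by rewrite [RHS]big_ord_recr /= t0 // addr0.
  have s0 : 1 - x ^+ (2 * r.+1) != 0 by rewrite mulnS sub1X_neq0.
  transitivity ((1 - x ^+ (2 * r.+1)) * (2 / (1 - x ^+ (2 * r.+1)))); last first.
    by rewrite mulrC divfK.
  rewrite -sum_theta_step !mulr_sumr -big_split /=; apply: eq_bigr => -[k kr] _ /=.
  case: (ltngtP k r.+1) => [kr1|kr1|->]; [|lia|]; last first.
    rewrite [t r _]t0 // mulr0 addr0 /t subnn.
    have -> : qfall x (r.+1 + r.+1) (2 * r.+1) = qpoch x x (2 * r.+1).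
      by rewrite -[(2 * _)%N]add0n addnn -mul2n -[X in qfall _ X _]add0n
        qfall_ratio qpoch0 divr1.
    rewrite mulnS add2n qpochS -exprS qpoch0 (_ : (r + r.+1 = (2 * r).+1)%N);
      last lia.
    by field; rewrite !xP xN.
  have [d ->] : exists d, r = (k + d)%N by exists (r - k)%N; lia.
  rewrite /t.
  have -> : (k + d + k = d + 2 * k)%N by lia.
  have -> : ((k + d).+1 + k = d.+1 + 2 * k)%N by lia.
  have -> : ((k + d).+1 - k = d.+1)%N by lia.
  have -> : (k + d - k = d)%N by lia.
  rewrite !qfall_ratio bin2S addSn !qpochS -!exprS.
  have -> : (2 * (k + d)).+1 = (k + k + d + d).+1 by lia.
  have -> : (2 * (k + d).+1)%N = (k + k + d + d).+2 by lia.
  have -> : (d + 2 * k)%N = (k + k + d)%N by lia.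
  have dd := sub1X_neq0 d; move: dd; rewrite !(exprS, exprD) => dd.
  field.
  by rewrite !xP xN dd.
have -> : \sum_(k < r.+2) t r.+1 k = 2 - x ^+ (2 * r).+1 * \sum_(k < r.+1) t r k.
  by rewrite -step addrK.
by ring.
Qed.

(** The factor [x^(r(r+1)/2)], which would spoil the telescoping, is absorbed by
    re-expanding in the family [qfall x (r + m) (2 * m)]. With [r = k + s] and
    [m = k + u] this is [qbin_vandermonde] for [c = x^(k+1)] and
    [b = x^(k+r+1)]. *)
Lemma falling_expand n r k : (r < n)%N ->
  x ^+ ('C(r.+1, 2) + 'C(r - k, 2)) * qfall x (r + k) (2 * k) / qpoch x x k =
  x ^+ 'C(k.+1, 2) * \sum_(m < n) (-1) ^+ (r + m) * x ^+ 'C(r - m, 2) *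
     qfall x (r + m) (2 * m) * qfall x m k / qpoch x x m ^+ 2.
Proof.
move=> rn; case: (leqP k r) => [kr|rk]; last first.
  rewrite qfall_small; last lia.
  rewrite mulr0 mul0r big1 ?mulr0 // => -[m mn] _ /=.
  case: (leqP m r) => mr.
    by rewrite [qfall x m k]qfall_small ?mulr0 ?mul0r //; lia.
  by rewrite qfall_small ?mulr0 ?mul0r //; lia.
have [s es] : exists s, r = (k + s)%N by exists (r - k)%N; lia.
rewrite (@big_ord_window _ (fun m => (-1) ^+ (r + m) * x ^+ 'C(r - m, 2) *
     qfall x (r + m) (2 * m) * qfall x m k / qpoch x x m ^+ 2) k s n).
- have := qbin_vandermonde x (x ^+ (k + k + s).+1) (x ^+ k.+1) s.
  have -> : \prod_(i < s) (x ^+ i * (x ^+ k.+1 * x ^+ i - x ^+ (k + k + s).+1)) =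
     x ^+ (2 * 'C(s, 2) + s * k.+1) * qfall x (k + s) s.
    rewrite /qfall exprD mul2n -addnn exprD -!prod_expr.
    have -> : x ^+ (s * k.+1) = \prod_(i < s) x ^+ k.+1.
      by rewrite prodr_const card_ord -exprM mulnC.
    rewrite -!big_split /=; apply: eq_bigr => -[i ir] _ /=.
    have -> : (k + k + s).+1 = (k.+1 + (i + (k + s - i)))%N by lia.
    by rewrite !exprD; ring.
  rewrite qfall_ratio => vdm.
  transitivity (x ^+ 'C(k.+1, 2) * (qpoch x x (k + k + s) / (qpoch x x s *
    qpoch x x (k + s)) *
     (x ^+ (2 * 'C(s, 2) + s * k.+1) * (qpoch x x (k + s) / qpoch x x k)))).
    have -> : ('C(r.+1, 2) + 'C(r - k, 2) = 'C(k.+1, 2) + (2 * 'C(s, 2) + s *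
      k.+1))%N.
      have -> : (r - k = s)%N by lia.
      by rewrite es -addSn bin2D; lia.
    have -> : (r + k = s + 2 * k)%N by lia.
    rewrite qfall_ratio exprD (_ : (s + 2 * k = k + k + s)%N); last lia.
    by field; rewrite !xP.
  congr (_ * _); rewrite -vdm mulr_sumr; apply: eq_bigr => -[u us] _ /=.
  have [v ev] : exists v, s = (u + v)%N by exists (s - u)%N; lia.
  have -> : qbin x s u = qbin x (u + v) u by rewrite ev.
  rewrite qbin_fact.
  have -> : (-1) ^+ (r + (k + u)) = (-1) ^+ v :> F.
    by rewrite -signr_odd -[RHS]signr_odd; congr (_ ^+ nat_of_bool _); lia.
  have -> : (s - u = v)%N by lia.
  have -> : (r - (k + u) = v)%N by lia.
  have -> : qfall x (r + (k + u)) (2 * (k + u)) = qpoch x x (k + k + s + u) /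
    qpoch x x v.
    have -> : (r + (k + u) = v + 2 * (k + u))%N by lia.
    by rewrite qfall_ratio; congr (qpoch _ _ _ / _); lia.
  have -> : qfall x (k + u) k = qpoch x x (k + u) / qpoch x x u.
    by rewrite addnC qfall_ratio.
  rewrite [qpoch x x (k + k + s + u)]qpoch_shift.
  have -> : x ^+ k.+1 * x ^+ u = x ^+ (k + u).+1 by rewrite -exprD addSn.
  have e2 : qpoch x x (k + s) = qpoch x x (k + u) * qpoch (x ^+ (k + u).+1) x v.
    by rewrite -qpoch_shift; congr qpoch; lia.
  have -> : qpoch (x ^+ (k + u).+1) x v = qpoch x x (k + s) / qpoch x x (k + u).
    by rewrite e2 mulrC mulKf.
  rewrite -ev; field; by rewrite !xP.
- by lia.
- by move=> m mk; rewrite [qfall x m k]qfall_small ?mulr0 ?mul0r //; lia.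
- by move=> m mk; rewrite qfall_small ?mulr0 ?mul0r //; lia.
Qed.

(** Expand [theta] by [theta_expand], change basis by [falling_expand], and sum
    over [r] by [telescope_sum]. *)
Lemma hecke_telescoped n : hecke x n =
  \sum_(m < n) bailey_beta x n m * telescoped x n m.
Proof.
transitivity (\sum_(r < n) \sum_(m < n)
   bailey_beta x n m * ((1 - x ^+ (2 * r).+1) *
     ((-1) ^+ (r + m) * x ^+ 'C(r - m, 2) * qfall x (r + m) (2 * m)))); last first.
  by rewrite exchange_big /=; apply: eq_bigr => m _;
    rewrite -mulr_sumr telescope_sum.
apply: eq_bigr => -[r rn] _ /=.
transitivity ((1 - x ^+ (2 * r).+1) * \sum_(k < n) (x ^+ ('C(r.+1, 2) + 'C(r -
  k, 2)) *
    qfall x (r + k) (2 * k) / qpoch x x k) / qpoch (- x) x k).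
  congr (_ * _); rewrite (theta_expand rn) mulrACA -expr2 -exprM mulnC exprM sqrrN.
  rewrite !expr1n mul1r mulr_sumr; apply: eq_bigr => k _.
  by rewrite exprD; field; rewrite xP xN.
rewrite mulr_sumr.
under [LHS]eq_bigr => k _ do rewrite (falling_expand _ rn) -!mulrA mulr_suml
  !mulr_sumr.
rewrite exchange_big /=; apply: eq_bigr => m _.
rewrite /bailey_beta !mulr_suml; apply: eq_bigr => k _.
by field; rewrite xP xN.
Qed.
End Field.

(** * Clearing denominators and differentiating *)

Definition telescoped_quo (R : comNzRingType) (x : R) (N m : nat) : R :=
  (-1) ^+ (N + m) * x ^+ 'C(N.+1 - m, 2) * (qfall x (N.+1 + m) m * qfall x N m).

Lemma telescoped_factor (R : comNzRingType) (x : R) N m :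
  telescoped x N.+1 m = (1 - x ^+ N.+1) * telescoped_quo x N m.
Proof.
rewrite /telescoped /telescoped_quo (_ : (2 * m).+1 = (m + m.+1)%N); last lia.
rewrite qfallD addnK qfallSS !exprS; ring.
Qed.

(** The product of [bailey_beta x N.+1 m] by [common_den x N], written without
    quotients so that it can be read as a polynomial. *)
Definition cleared_coef (R : comNzRingType) (x : R) (N m : nat) : R :=
  (\sum_(k < N.+1) x ^+ 'C(k.+1, 2) * qfall x m k * qpoch (- x ^+ k.+1) x (N - k))
  * qpoch (x ^+ m.+1) x (N - m) ^+ 2.

Definition common_den (R : comNzRingType) (x : R) (N : nat) : R :=
  qpoch (- x) x N * qpoch x x N ^+ 2.

Section Den.
Variables (F : fieldType) (x : F) (N : nat).
Hypothesis xP : forall k, (k <= N)%N -> qpoch x x k != 0.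
Hypothesis xN : forall k, (k <= N)%N -> qpoch (- x) x k != 0.

Lemma common_den_coef m : (m <= N)%N ->
  common_den x N * bailey_beta x N.+1 m = cleared_coef x N m.
Proof.
move=> mN; rewrite /common_den /cleared_coef /bailey_beta.
have em : qpoch x x N = qpoch x x m * qpoch (x ^+ m.+1) x (N - m).
  by rewrite -qpoch_shift subnKC.
transitivity ((qpoch (- x) x N *
   \sum_(k < N.+1) x ^+ 'C(k.+1, 2) * qfall x m k / qpoch (- x) x k) *
   (qpoch x x N / qpoch x x m) ^+ 2).
  by field; rewrite xP.
congr (_ * _ ^+ 2); last by rewrite em mulrC mulKf // xP.
rewrite mulr_sumr; apply: eq_bigr => -[k kN] _ /=; rewrite ltnS in kN.
have -> : qpoch (- x) x N = qpoch (- x) x k * qpoch (- x ^+ k.+1) x (N - k).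
  by rewrite -[in LHS](subnKC kN) qpochD mulNr exprS.
by field; rewrite xN.
Qed.
End Den.

Section Morph.
Variables (R S : comNzRingType) (f : {rmorphism R -> S}).

Lemma rmorph_qpoch a x k : f (qpoch a x k) = qpoch (f a) (f x) k.
Proof. by rewrite rmorph_prod; apply: eq_bigr => i _;
  rewrite rmorphB rmorphM rmorphXn rmorph1. Qed.

Lemma rmorph_qfall x n k : f (qfall x n k) = qfall (f x) n k.
Proof. by rewrite rmorph_prod; apply: eq_bigr => i _;
  rewrite rmorphB rmorphXn rmorph1. Qed.

Lemma rmorph_hecke x n : f (hecke x n) = hecke (f x) n.
Proof.
rewrite rmorph_sum; apply: eq_bigr => r _.
rewrite !rmorphM rmorphB rmorph1 !rmorphXn rmorphN1 rmorph_sum; congr (_ * (_ * _)).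
by apply: eq_bigr => i _; rewrite rmorphM !rmorphXn rmorphN1.
Qed.

Lemma rmorph_telescoped_quo x N m : f (telescoped_quo x N m) = telescoped_quo
  (f x) N m.
Proof. by rewrite !rmorphM !rmorph_qfall !rmorphXn rmorphN1. Qed.

Lemma rmorph_common_den x N : f (common_den x N) = common_den (f x) N.
Proof. by rewrite rmorphM rmorphXn !rmorph_qpoch rmorphN. Qed.

Lemma rmorph_cleared_coef x N m : f (cleared_coef x N m) = cleared_coef (f x) N m.
Proof.
rewrite rmorphM rmorphXn rmorph_qpoch rmorphXn rmorph_sum; congr (_ * _).
by apply: eq_bigr => k _; rewrite !rmorphM rmorph_qpoch rmorph_qfall rmorphN
  !rmorphXn.
Qed.
End Morph.

Lemma qpochX_neq0 (F : fieldType) (a : {poly F}) k :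
  a.[0] = 0 -> qpoch a 'X k != 0.
Proof.
move=> a0; apply/eqP => e; have := oner_neq0 F; rewrite -(horner0 (0 : F)) -e.
rewrite /qpoch horner_prod big1 ?eqxx // => i _.
by rewrite hornerD hornerN hornerM a0 mul0r subr0 hornerC.
Qed.

(** [hecke_telescoped] at the generic point, namely the indeterminate in the
    field of rational functions, where no Pochhammer product vanishes. Clearing
    denominators makes the identity meaningful at a root of unity too. *)
Lemma hecke_poly (F : fieldType) N :
  common_den 'X N * hecke 'X N.+1 =
  (1 - 'X ^+ N.+1) *
    \sum_(m < N.+1) cleared_coef 'X N m * telescoped_quo 'X N m :> {poly F}.
Proof.
apply/eqP; rewrite -tofrac_eq; apply/eqP.
pose x : {fraction {poly F}} := FracField.tofrac ('X : {poly F}).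
have xP k : qpoch x x k != 0.
  by rewrite -rmorph_qpoch tofrac_eq0 qpochX_neq0 // hornerX.
have xN k : qpoch (- x) x k != 0.
  by rewrite -rmorphN -rmorph_qpoch tofrac_eq0 qpochX_neq0 // hornerN hornerX oppr0.
have x0 : x != 0 by rewrite tofrac_eq0 polyX_eq0.
rewrite rmorphM rmorph_common_den rmorph_hecke rmorphM rmorphB rmorph1 rmorphXn
  rmorph_sum -/x.
rewrite (hecke_telescoped x0 xP xN) !mulr_sumr; apply: eq_bigr => -[m mN] _ /=.
by rewrite rmorphM rmorph_cleared_coef rmorph_telescoped_quo -/x
  telescoped_factor -(@common_den_coef _ x) //; ring.
Qed.

(** At [p] both [P] and [1 - X^n] vanish, so only the terms in which the
    derivative falls on them survive. *)
Lemma deriv_at_root (F : fieldType) (D P H : {poly F}) (p : F) n :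
  D * P = (1 - 'X^n) * H -> p ^+ n = 1 -> D.[p] != 0 ->
  p * P^`().[p] * D.[p] = - n%:R * H.[p].
Proof.
move=> e pn Dp.
have Pp : P.[p] = 0.
  apply: (mulfI Dp); rewrite mulr0 -hornerM e hornerM hornerD hornerN hornerXn.
  by rewrite hornerC pn subrr mul0r.
have := congr1 (fun Q => Q^`().[p]) e.
rewrite /= !derivM derivB derivC sub0r derivXn !hornerE pn Pp subrr mulr0 add0r
  mul0r addr0.
move=> e'; rewrite -mulrA [P^`().[p] * _]mulrC e' hornerMn hornerXn.
case: n pn {e e'} => [|n] pn; first by rewrite !mulr0n; ring.
by rewrite -mulr_natr mulrA mulrN mulrA -exprS pn mul1r.
Qed.

(** * Evaluation at a root of unity *)

Section RootOfUnity.
Variables (F : numFieldType) (N h : nat) (p q : F).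
Hypothesis pprim : N.+1.-primitive_root p.
Hypothesis Nodd : N = h.*2.
Hypothesis pq : p * q = 1.

Let p0 : p != 0.
Proof. by apply: contra_eq_neq pq => ->; rewrite mul0r eq_sym oner_eq0. Qed.

Lemma rootXV k : p ^+ k * q ^+ k = 1.
Proof. by rewrite -exprMn pq expr1n. Qed.

Lemma rootXB m i : (i <= m)%N -> p ^+ m * q ^+ i = p ^+ (m - i).
Proof. by move=> im; rewrite -{1}(subnK im) exprD -mulrA rootXV mulr1. Qed.

Lemma qpoch_root_neq0 k : (k <= N)%N -> qpoch p p k != 0.
Proof.
move=> kN; apply/prodf_neq0 => -[i ik] _ /=.
rewrite -exprS subr_eq0 eq_sym -(prim_order_dvd pprim).
by rewrite gtnNdvd // ltnS (leq_trans ik).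
Qed.

(** As a function of [y = p^m], [qfall p m k] is a polynomial of degree [k < n]
    with constant term 1; averaging over the [n]-th roots of unity keeps only
    that constant term. This is the source of one of the two factors [n]. *)
Lemma sum_qfall k : (k <= N)%N -> \sum_(m < N.+1) qfall p m k = N.+1%:R.
Proof.
move=> kN.
transitivity (\sum_(m < N.+1) qpoch (p ^+ m) q k).
  apply: eq_bigr => -[m mN] _ /=; case: (leqP k m) => km.
    by apply: eq_bigr => -[i ik] _ /=; rewrite rootXB // ltnW // (leq_trans ik).
  rewrite qfall_small // /qpoch (bigD1 (Ordinal km)) //= rootXB // subnn expr0.
  by rewrite subrr mul0r.
under eq_bigr => m _ do rewrite -qbin_binomial.
rewrite exchange_big /= big_ord_recl [X in _ + X]big1 ?addr0 => [|[j jk] _].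
  under eq_bigr do rewrite qbin0 !expr0 !mulr1.
  by rewrite sumr_const card_ord.
rewrite -mulr_sumr; apply/eqP; rewrite mulf_eq0; apply/orP; right.
rewrite -mulr_suml mulf_eq0; apply/orP; left; rewrite /bump /= ?add1n.
under eq_bigr => m _ do rewrite -mulN1r exprMn -exprM mulnC exprM.
rewrite -mulr_sumr mulf_eq0; apply/orP; right.
have : (p ^+ j.+1 - 1) * \sum_(m < N.+1) p ^+ j.+1 ^+ m == 0.
  by rewrite -subrX1 -exprM mulnC exprM (prim_expr_order pprim) // expr1n subrr.
rewrite mulf_eq0 subr_eq0 -(prim_order_dvd pprim) gtnNdvd //.
by rewrite ltnS (leq_trans jk).
Qed.

Lemma sum_qbin k : (k <= N)%N ->
  \sum_(m < N.+1) qbin p m k = N.+1%:R / qpoch p p k.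
Proof.
move=> kN; apply: (canRL (mulfK (qpoch_root_neq0 kN))).
by rewrite mulr_suml -(sum_qfall kN); apply: eq_bigr => m _; rewrite qbin_qpoch.
Qed.

Lemma qpoch_inv k : qpoch p p k = (-1) ^+ k * p ^+ 'C(k.+1, 2) * qpoch q q k.
Proof.
elim: k => [|k IH]; first by rewrite !qpoch0 !expr0 !mulr1.
rewrite !qpochS IH [in RHS]bin2S exprD exprS.
have -> : 1 - p * p ^+ k = - (p ^+ k.+1 * (1 - q * q ^+ k)).
  by rewrite -!exprS mulrBr rootXV; ring.
by ring.
Qed.

Lemma qfall_root m : (m <= N)%N -> qfall p (N.+1 + m) m = qpoch p p m.
Proof.
move=> mN; rewrite -[m in RHS]add0n -qfall_qpoch qpoch0 mulr1.
apply: eq_bigr => -[i im] _ /=; rewrite add0n -addnBA ?(ltnW im) // exprD.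
by rewrite (prim_expr_order pprim) mul1r.
Qed.

Lemma qfall_root_pred m : (m <= N)%N ->
  (-1) ^+ m * p ^+ 'C(m.+1, 2) * qfall p N m = qpoch p p m.
Proof.
elim: m => [|m IH] mN; first by rewrite qfall0 qpoch0 !expr0 !mulr1.
rewrite qfallS qpochS -IH ?(ltnW mN) // [in LHS]bin2S exprD exprS.
have -> : 1 - p * p ^+ m = - p ^+ m.+1 * (1 - p ^+ (N - m)).
  have e : p ^+ m.+1 * p ^+ (N - m) = 1.
    by rewrite -exprD addSn subnKC ?(prim_expr_order pprim) // ltnW.
  by rewrite mulNr mulrBr e -exprS; ring.
by ring.
Qed.

Lemma telescoped_quo_root m : (m <= N)%N -> telescoped_quo p N m = qpoch p p m ^+ 2.
Proof.
move=> mN; rewrite /telescoped_quo qfall_root // expr2 -{3}qfall_root_pred //.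
have -> : p ^+ 'C(N.+1 - m, 2) = p ^+ 'C(m.+1, 2).
  (* The exponents agree modulo n = 2h + 1; oddness of n is used here. *)
  have eq : ('C(N.+1 - m, 2) + N.+1 * m = 'C(m.+1, 2) + N.+1 * h)%N.
    have [d ed] : exists d, N.+1 = (m + d)%N by exists (N.+1 - m)%N; lia.
    have := bin2_sq (N.+1 - m); have := bin2_sq m.+1.
    rewrite (_ : (N.+1 - m = d)%N); last lia.
    by nia.
  have pn e : p ^+ (N.+1 * e) = 1 by rewrite exprM (prim_expr_order pprim) expr1n.
  by rewrite -[LHS]mulr1 -{1}(pn m) -exprD eq exprD pn mulr1.
have -> : (-1) ^+ (N + m) = (-1) ^+ m :> F.
  by rewrite exprD Nodd -muln2 mulnC exprM sqrrN expr1n expr1n mul1r.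
by ring.
Qed.

(** Evaluate [X^n - 1], the product of the [X - p^i], at [-1]; the factor
    [i = 0] accounts for the 2 that is cancelled. *)
Lemma qpochN_full : qpoch (- p) p N = 1.
Proof.
have := congr1 (horner^~ (- 1)) (factor_Xn_sub_1 pprim).
rewrite /= big_mkord horner_prod hornerD hornerN hornerXn hornerC => e.
have two : (2 : F) != 0 by rewrite pnatr_eq0.
apply: (mulfI two); rewrite mulr1; apply: oppr_inj.
have eN : (-1) ^+ N.+1 = - 1 :> F.
  by rewrite exprS Nodd -muln2 mulnC exprM sqrrN !expr1n mulr1.
transitivity (- 1 - 1 : F); last by ring.
rewrite eN in e; rewrite -{}e.
have -> : \prod_(i < N.+1) ('X - (p ^+ i)%:P).[-1] = (-1) ^+ N.+1 * qpoch (- 1)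
  p N.+1.
  rewrite -[X in _ ^+ X]card_ord -prodr_const -big_split /=; apply: eq_bigr => i _.
  by rewrite hornerXsubC; ring.
by rewrite eN qpochSl [-1 * p]mulN1r; ring.
Qed.

(** Moving one factor from the second product to the first one replaces
    [1 + p^(n-k-1)] by [1 + p^(k+1)], which is [p^(k+1)] times as large. *)
Lemma qpochN_split k : (k <= N)%N ->
  qpoch (- p) p k * qpoch (- p) p (N - k) = p ^+ 'C(k.+1, 2).
Proof.
elim: k => [|k IH] kN; first by rewrite subn0 qpoch0 mul1r qpochN_full.
rewrite bin2S exprD -IH ?(ltnW kN) // (_ : (N - k = (N - k.+1).+1)%N); last lia.
rewrite !qpochS.
have -> : 1 - - p * p ^+ k = p ^+ k.+1 * (1 - - p * p ^+ (N - k.+1)).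
  rewrite !mulNr !opprK mulrDr -!exprS -exprD addnS subnKC //.
  by rewrite (prim_expr_order pprim); ring.
by ring.
Qed.

Lemma qpochN_root_neq0 k : (k <= N)%N -> qpoch (- p) p k != 0.
Proof.
move=> kN; apply/negP => /eqP e; have := qpochN_split kN.
by rewrite e mul0r => /esym/eqP; apply/negP; rewrite expf_neq0.
Qed.

Lemma sum_inv_qpochN :
  \sum_(k < N.+1) p ^+ 'C(k.+1, 2) / qpoch (- p) p k =
  \sum_(m < N.+1) qpoch (- p) p m.
Proof.
rewrite [RHS](reindex_inj rev_ord_inj) /=; apply: eq_bigr => -[k kN] _ /=.
by rewrite -qpochN_split // mulrC mulKf // qpochN_root_neq0.
Qed.

(** Expand each product by the q-binomial theorem and sum over the row index
    first. *)
Lemma sum_qpochN : \sum_(m < N.+1) qpoch (- p) p m =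
  \sum_(r < N.+1) (-1) ^+ r * (N.+1%:R / qpoch q q r).
Proof.
transitivity (\sum_(m < N.+1) \sum_(r < N.+1) qbin p m r * p ^+ 'C(r.+1, 2)).
  apply: eq_bigr => -[m mN] _ /=; rewrite -qbin_binomial opprK.
  rewrite [RHS](@big_ord_window _ (fun r => qbin p m r * p ^+ 'C(r.+1, 2)) 0 m) //.
    by apply: eq_bigr => r _; rewrite bin2S -exprD addnC add0n.
  by move=> r mr; rewrite qbin_small ?mul0r.
rewrite exchange_big; apply: eq_bigr => -[r rN] _ /=.
rewrite -mulr_suml sum_qbin // qpoch_inv.
have := qpoch_root_neq0 (rN : (r <= N)%N);
  rewrite qpoch_inv !mulf_eq0 => /norP[/norP[s0 c0] r0].
rewrite [in RHS](_ : (-1) ^+ r = ((-1) ^+ r)^-1); last by rewrite -exprVn invrN1.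
by field; rewrite r0 c0 s0.
Qed.

Lemma q_primitive : N.+1.-primitive_root q.
Proof.
have -> : q = p ^+ N.
  by apply: (mulfI p0); rewrite pq -exprS (prim_expr_order pprim).
by rewrite prim_root_exp_coprime // coprimenS.
Qed.

End RootOfUnity.

(** Here the q-binomial coefficients enter through their alternating row sums,
    and summing over the row index first leads to the same expression as in
    [sum_qpochN]. *)
Lemma sum_qpoch_odd (F : numFieldType) (N h : nat) (p q : F) :
  N.+1.-primitive_root p -> N = h.*2 -> p * q = 1 ->
  \sum_(k < h.+1) qpoch_odd q k =
  \sum_(r < N.+1) (-1) ^+ r * (N.+1%:R / qpoch q q r).
Proof.
move=> pprim Nodd pq; have qprim := q_primitive pprim pq.
rewrite -sum_qbin_alt -Nodd exchange_big; apply: eq_bigr => -[r rN] _ /=.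
by rewrite -mulr_suml (sum_qbin qprim (etrans (mulrC _ _) pq)) // mulrC.
Qed.

(** The theorem in polynomial form. One factor [n] is the derivative of
    [1 - X^n], the other one is the average of [sum_qfall]. *)
Lemma hecke_deriv_root (F : numFieldType) (N h : nat) (p q : F) :
  N.+1.-primitive_root p -> N = h.*2 -> p * q = 1 ->
  p * (hecke 'X N.+1)^`().[p] =
  - N.+1%:R ^+ 2 * \sum_(k < h.+1) qpoch_odd q k.
Proof.
move=> pprim Nodd pq.
have xP := qpoch_root_neq0 pprim; have xN := qpochN_root_neq0 pprim Nodd pq.
have denp : (common_den 'X N).[p] = common_den p N.
  by rewrite -[LHS]/(horner_eval p _) rmorph_common_den /= horner_evalE hornerX.
have d0 : common_den p N != 0 by rewrite mulf_neq0 ?expf_neq0 ?xP ?xN.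
have := deriv_at_root (hecke_poly F N) (prim_expr_order pprim).
rewrite denp => /(_ d0) e.
apply: (mulIf d0); rewrite {}e.
rewrite (sum_qpoch_odd pprim Nodd pq) -(sum_qpochN pprim pq) -(sum_inv_qpochN
  pprim Nodd pq).
transitivity (- N.+1%:R * (common_den p N * \sum_(m < N.+1) \sum_(k < N.+1)
   p ^+ 'C(k.+1, 2) / qpoch (- p) p k * qfall p m k)).
  congr (_ * _); rewrite horner_sum mulr_sumr; apply: eq_bigr => -[m mN] _ /=.
  rewrite hornerM -[(cleared_coef _ _ _).[p]]/(horner_eval p _)
    -[(telescoped_quo _ _ _).[p]]/(horner_eval p _).
  rewrite rmorph_cleared_coef rmorph_telescoped_quo /= horner_evalE hornerX
    (telescoped_quo_root pprim Nodd pq) //.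
  rewrite -(common_den_coef xP xN) // -mulrA /bailey_beta divfK;
    last by rewrite expf_neq0 ?xP.
  by congr (_ * _); apply: eq_bigr => k _; rewrite mulrAC.
rewrite exchange_big /=.
under eq_bigr => k _.
  have kN : (k <= N)%N by have := ltn_ord k.
  rewrite -mulr_sumr (sum_qfall pprim pq kN).
  over.
by rewrite -mulr_suml; ring.
Qed.

(** * The sum over integers as a derivative *)

(** The exponent [k(3k+1)/2 - j^2] for [k = r] and [j = i - r]. *)
Definition hexp (r i : nat) : nat := ('C(r.+1, 2) + i * (2 * r - i))%N.

Lemma hecke_monomials (F : fieldType) (n : nat) :
  hecke 'X n = \sum_(r < n) \sum_(i < (2 * r).+1)
    (-1) ^+ i *: ('X^(hexp r i) - 'X^(hexp r i + (2 * r).+1)) :> {poly F}.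
Proof.
apply: eq_bigr => r _; rewrite /theta !mulr_sumr; apply: eq_bigr => i _.
rewrite exprD -mul_polyC rmorphXn rmorphN1 /hexp.
rewrite ['X^(_ + (2 * r).+1)]exprD ['X^('C(_, _) + _)]exprD.
by rewrite -[(-1) ^+ r]signr_odd; case: (odd r); ring.
Qed.

Lemma hecke_deriv_monomials (F : fieldType) (n : nat) (p : F) :
  p * (hecke 'X n)^`().[p] = \sum_(r < n) \sum_(i < (2 * r).+1)
    (-1) ^+ i * ((hexp r i)%:R * p ^+ hexp r i -
       (hexp r i + (2 * r).+1)%:R * p ^+ (hexp r i + (2 * r).+1)).
Proof.
have dX e : p * ('X^e : {poly F})^`().[p] = e%:R * p ^+ e.
  rewrite derivXn hornerMn hornerXn; case: e => [|e]; first by rewrite mulr0n; ring.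
  by rewrite -mulr_natr exprS /=; ring.
rewrite hecke_monomials raddf_sum /= horner_sum mulr_sumr; apply: eq_bigr => r _.
rewrite raddf_sum /= horner_sum mulr_sumr; apply: eq_bigr => i _.
by rewrite derivZ derivB hornerZ hornerD hornerN mulrCA mulrBr !dX.
Qed.

Lemma sumz_sym (V : zmodType) (r : nat) (f : int -> V) :
  sumz (- r%:Z) r f = \sum_(i < (2 * r).+1) f (i%:Z - r%:Z).
Proof.
rewrite /sumz ifT; last lia.
rewrite (_ : absz _ = (2 * r).+1) ?big_mkord; last lia.
by apply: eq_bigr => i _; rewrite addrC.
Qed.

Lemma sumz_antisym (V : zmodType) (r : nat) (f : int -> V) :
  sumz r.+1 (- r.+1%:Z) f = - \sum_(i < (2 * r).+1) f (i%:Z - r%:Z).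
Proof.
rewrite /sumz (_ : (r.+1%:Z <= - r.+1%:Z) = false); last by lia.
rewrite (_ : absz _ = (2 * r).+1) ?big_mkord; last lia.
by congr (- _); apply: eq_bigr => i _; congr f; lia.
Qed.

(** Pairs [k = r] with [k = - r - 1]: the two inner sums then run over the same
    values of [j], with opposite signs by [sumz_antisym]. *)
Lemma sumz_fold (V : zmodType) (n : nat) (g : int -> V) : (0 < n)%N ->
  sumz (- n%:Z) (n%:Z - 1) g = \sum_(r < n) (g r + g (- r.+1%:Z)).
Proof.
move=> n0; rewrite /sumz ifT; last lia.
rewrite (_ : absz _ = (n + n)%N) ?big_mkord; last lia.
rewrite big_split_ord big_split /= addrC; congr (_ + _).
  by apply: eq_bigr => i _; congr g; lia.
rewrite (reindex_inj rev_ord_inj) /=; apply: eq_bigr => -[i ni] _; congr g => /=.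
by lia.
Qed.

Lemma pent_hexp (r i : nat) : (i <= 2 * r)%N ->
  pent r - (i%:Z - r%:Z) ^+ 2 = hexp r i.
Proof.
move=> ir; have := pentE r; have := bin2_sq r.+1; rewrite /hexp; nia.
Qed.

Lemma pent_hexp_neg (r i : nat) : (i <= 2 * r)%N ->
  pent (- r.+1%:Z) - (i%:Z - r%:Z) ^+ 2 = (hexp r i + (2 * r).+1)%N.
Proof.
move=> ir; have := pentE (- r.+1%:Z); have := bin2_sq r.+1; rewrite /hexp; nia.
Qed.

Lemma sum_setT_qpoch_odd (F : fieldType) (h : nat) (q : F) :
  q ^+ h.*2.+1 = 1 ->
  \sum_(k \in [set: nat]%classic) qpoch_odd q k = \sum_(k < h.+1) qpoch_odd q k.
Proof.
move=> qh; rewrite (fsbig_ord _ h.+1 (qpoch_odd q)); apply/esym/fsbig_widen => //.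
move=> k [_ /negP]; rewrite /= -leqNgt => hk.
by rewrite /qpoch_odd (bigD1 (Ordinal hk)) //= mul2n addn1 qh subrr mul0r.
Qed.

Local Open Scope complex_scope.

Theorem proposition3p4 (R : realType) (n : nat) (q : R[i])
  (hn : (1 <= n)%N) (hodd : odd n) (hq : n.-primitive_root q) :
  \sum_(k \in [set: nat]%classic) qpoch_odd q k =
  (-1 / n%:R ^+ 2) *
  sumz (- n%:Z) (n%:Z - 1) (fun k : int =>
    sumz (- k) k (fun j : int =>
      (sgn k)%:~R * (pent k - j ^+ 2)%:~R * (-1) ^ (k + j)
      * q ^ (- pent k + j ^+ 2))).
Proof.
case: n hn hodd hq => // N _ /= Nodd qprim.
have {Nodd} eN : N = N./2.*2 by have := odd_double_half N; lia.
set h := N./2 in eN.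
pose p := q^-1.
have q0 : q != 0 by rewrite (prim_root_eq0 qprim).
have pq : p * q = 1 by rewrite mulVf.
have pprim : N.+1.-primitive_root p by apply: q_primitive qprim _; rewrite mulfV.
rewrite (@sum_setT_qpoch_odd _ h) -?eN ?(prim_expr_order qprim) //.
have n0 : N.+1%:R != 0 :> R[i] by rewrite pnatr_eq0.
rewrite sumz_fold //.
rewrite (_ : \sum_(r < N.+1) _ = p * (hecke 'X N.+1)^`().[p]).
  by rewrite (hecke_deriv_root pprim eN pq); move: N.+1%:R n0 => c c0; field.
rewrite hecke_deriv_monomials; apply: eq_bigr => r _.
rewrite opprK sumz_sym sumz_antisym -sumrB; apply: eq_bigr => i _.
have ir : (i <= 2 * r)%N by have := ltn_ord i.
rewrite ![- pent _ + _]addrC -![_ - pent _]opprB.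
rewrite pent_hexp // pent_hexp_neg // -!exprnN -!exprVn -/p !pmulrn.
rewrite addrCA subrr addr0 -exprnP.
have -> : (-1) ^ (- r.+1%:Z + (i%:Z - r%:Z)) = - (-1) ^+ i :> R[i].
  rewrite (_ : - r.+1%:Z + (i%:Z - r%:Z) = i.+1%:Z + 2 * - r.+1%:Z); last lia.
  rewrite expfzDr ?oppr_eq0 ?oner_eq0 // -exprz_exp.
  rewrite (_ : (-1) ^ 2 = 1) ?exp1rz; last by rewrite -exprnP sqrrN expr1n.
  by rewrite mulr1 -exprnP exprS mulN1r.
have -> : sgn r = 1 by [].
have -> : sgn (- r.+1%:Z) = - 1 by [].
by rewrite mulr1z mulrN1z mul1r mulN1r mulNr mulrN opprK mulrBr mulrCA -!mulrA;
  congr (_ - _); rewrite mulrCA.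
Qed.
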